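(* Let $\mathcal{C}$ be a multitensor category, $\mathcal{M}$ a left $\mathcal{C}$-module category, and $\mathsf{M}$ an object of $\mathcal{M}$ such that the functor $\mathcal{G}_{\mathsf{M},\mathsf{M}}:\mathsf{X}\mapsto\mathrm{Hom}_{\mathcal{M}}(\mathsf{X}\otimes\mathsf{M},\mathsf{M})$ is representable, with representing object $\mathsf{A}:=\underline{\mathrm{Hom}}(\mathsf{M},\mathsf{M})$ and natural isomorphisms $$\lambda_{\mathsf{X}}:\mathrm{Hom}_{\mathcal{M}}(\mathsf{X}\otimes\mathsf{M},\mathsf{M})\xrightarrow{\ \cong\ }\mathrm{Hom}_{\mathcal{C}}(\mathsf{X},\mathsf{A}),\qquad \mathsf{X}\in\mathrm{Obj}(\mathcal{C}).$$ Then $\mathsf{A}$, together with left unit $\iota_{\mathsf{A}}=\lambda_{\mathbf{1}}(l_{\mathsf{M}}):\mathbf{1}\to\mathsf{A}$ and multiplication $$m=\lambda_{\mathsf{A}\otimes\mathsf{A}}\Big(\lambda_{\mathsf{A}}^{-1}(\mathrm{Id}_{\mathsf{A}})\circ\big(\mathrm{Id}_{\mathsf{A}}\otimes\lambda_{\mathsf{A}}^{-1}(\mathrm{Id}_{\mathsf{A}})\big)\circ\mathcal{A}_{\mathsf{A},\mathsf{A},\mathsf{M}}^{-1}\Big):\mathsf{A}\otimes\mathsf{A}\to\mathsf{A},$$ is a left-unital associative algebra in $\mathcal{C}$.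
   Context: $\mathcal C$ is an $\mathbb F$-linear abelian (multi)tensor category ($\mathbb F$ a field): a monoidal category with bilinear $\otimes$, unit $\mathbf 1$ (not necessarily simple), unit isomorphisms $l,r$ and associativity isomorphisms $\mathcal A_{\mathsf X,\mathsf Y,\mathsf Z}:\mathsf X\otimes(\mathsf Y\otimes\mathsf Z)\to(\mathsf X\otimes\mathsf Y)\otimes\mathsf Z$ satisfying triangle and pentagon axioms; it is not assumed braided or finite. A left $\mathcal C$-module category $\mathcal M$ has an action bifunctor $\otimes:\mathcal C\times\mathcal M\to\mathcal M$ with natural isomorphisms $\mathcal A_{\mathsf X_1,\mathsf X_2,\mathsf M}:\mathsf X_1\otimes(\mathsf X_2\otimes\mathsf M)\to(\mathsf X_1\otimes\mathsf X_2)\otimes\mathsf M$ and $l_{\mathsf M}:\mathbf 1\otimes\mathsf M\to\mathsf M$ satisfying the usual pentagon and triangle axioms. The contravariant functor $\mathcal G_{\mathsf M,\mathsf M}:\mathcal C\to\mathrm{Vec}_{\mathbb F}$ acts on morphisms by $f\mapsto(g\mapsto g\circ(f\otimes\mathrm{Id}_{\mathsf M}))$; naturality of $\lambda$ means $\lambda_{\mathsf X}(g\circ(f\otimes\mathrm{Id}_{\mathsf M}))=\lambda_{\mathsf Y}(g)\circ f$ for $f:\mathsf X\to\mathsf Y$, $g:\mathsf Y\otimes\mathsf M\to\mathsf M$. Left-unital associative algebra means $m\circ(\mathrm{Id}_{\mathsf A}\otimes m)=m\circ(m\otimes\mathrm{Id}_{\mathsf A})\circ\mathcal A_{\mathsf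 A,\mathsf A,\mathsf A}$ and $m\circ(\iota_{\mathsf A}\otimes\mathrm{Id}_{\mathsf A})=l_{\mathsf A}$. *)

(* Defs.v *)
From mathcomp Require Import all_boot all_algebra.

Set Implicit Arguments.
Unset Strict Implicit.
Unset Printing Implicit Defensive.

Import GRing.Theory.
Local Open Scope ring_scope.

Declare Scope cat_scope.
Delimit Scope cat_scope with cat.


Record linear_category (F : fieldType) := LinearCategory {
  obj :> Type;
  mor : obj -> obj -> lmodType F;
  idm : forall X, mor X X;
  compm : forall X Y Z, mor Y Z -> mor X Y -> mor X Z;
  compm_idl : forall X Y (f : mor X Y), compm (idm Y) f = f;
  compm_idr : forall X Y (f : mor X Y), compm f (idm X) = f;
  compmA : forall W X Y Z (h : mor Y Z) (g : mor X Y) (f : mor W X),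
    compm h (compm g f) = compm (compm h g) f;
  compm_linear_l : forall X Y Z (f : mor X Y),
    linear (fun g : mor Y Z => compm g f);
  compm_linear_r : forall X Y Z (g : mor Y Z),
    linear (fun f : mor X Y => compm g f)
}.

Arguments mor {F l} X Y.
Arguments idm {F l} X.
Arguments compm {F l X Y Z} g f.

Notation "g ∘ f" := (compm g f)
  (at level 40, left associativity) : cat_scope.
Local Open Scope cat_scope.

Record iso (F : fieldType) (C : linear_category F) (X Y : C) := Iso {
  iso_hom : mor X Y;
  iso_inv : mor Y X;
  iso_homK : iso_inv ∘ iso_hom = idm X;
  iso_invK : iso_hom ∘ iso_inv = idm Y
}.

Section Abelian.
Variables (F : fieldType) (C : linear_category F).

Definition is_zero_object (Z : C) : Prop :=
  (forall X (f : mor X Z), f = 0) /\ (forall X (f : mor Z X), f = 0).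

Definition is_biproduct (X Y P : C) (iX : mor X P) (iY : mor Y P)
    (pX : mor P X) (pY : mor P Y) : Prop :=
  [/\ pX ∘ iX = idm X, pY ∘ iY = idm Y, pY ∘ iX = 0, pX ∘ iY = 0
    & iX ∘ pX + iY ∘ pY = idm P].

Definition is_kernel (K X Y : C) (k : mor K X) (f : mor X Y) : Prop :=
  f ∘ k = 0 /\
  forall W (g : mor W X), f ∘ g = 0 -> exists! u : mor W K, k ∘ u = g.

Definition is_cokernel (X Y Q : C) (q : mor Y Q) (f : mor X Y) : Prop :=
  q ∘ f = 0 /\
  forall W (g : mor Y W), g ∘ f = 0 -> exists! u : mor Q W, u ∘ q = g.

Definition mono (X Y : C) (f : mor X Y) : Prop :=
  forall W (g h : mor W X), f ∘ g = f ∘ h -> g = h.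

Definition epi (X Y : C) (f : mor X Y) : Prop :=
  forall W (g h : mor Y W), g ∘ f = h ∘ f -> g = h.

Record is_abelian : Prop := Abelian {
  ab_zero : exists Z : C, is_zero_object Z;
  ab_biproduct : forall X Y : C, exists (P : C) (iX : mor X P) (iY : mor Y P)
    (pX : mor P X) (pY : mor P Y), is_biproduct iX iY pX pY;
  ab_kernel : forall (X Y : C) (f : mor X Y),
    exists (K : C) (k : mor K X), is_kernel k f;
  ab_cokernel : forall (X Y : C) (f : mor X Y),
    exists (Q : C) (q : mor Y Q), is_cokernel q f;
  ab_mono : forall (X Y : C) (f : mor X Y), mono f ->
    exists (Z : C) (g : mor Y Z), is_kernel f g;
  ab_epi : forall (X Y : C) (f : mor X Y), epi f ->
    exists (W : C) (g : mor W X), is_cokernel f g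
}.

End Abelian.


Record bifunctor (F : fieldType) (C D E : linear_category F) := Bifunctor {
  bobj :> C -> D -> E;
  bmor : forall (X X' : C) (Y Y' : D),
    mor X X' -> mor Y Y' -> mor (bobj X Y) (bobj X' Y');
  bmor_id : forall X Y, bmor (idm X) (idm Y) = idm (bobj X Y);
  bmor_comp : forall (X X' X'' : C) (Y Y' Y'' : D)
    (f' : mor X' X'') (f : mor X X') (g' : mor Y' Y'') (g : mor Y Y'),
    bmor (f' ∘ f) (g' ∘ g) = bmor f' g' ∘ bmor f g
}.

Definition bifunctor_bilinear (F : fieldType) (C D E : linear_category F)
    (T : bifunctor C D E) : Prop :=
  (forall (X X' : C) (Y Y' : D) (g : mor Y Y'),
     linear (fun f : mor X X' => bmor T f g)) /\
  (forall (X X' : C) (Y Y' : D) (f : mor X X'),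
     linear (fun g : mor Y Y' => bmor T f g)).


(* The unit object need not be simple; neither rigidity nor any finiteness
   condition is imposed. *)
Record multitensor_category (F : fieldType) := MultitensorCategory {
  mt_cat :> linear_category F;
  mt_abelian : is_abelian mt_cat;
  tensor : bifunctor mt_cat mt_cat mt_cat;
  tensor_bilinear : bifunctor_bilinear tensor;
  unit_obj : mt_cat;
  lunit : forall X, iso (tensor unit_obj X) X;
  runit : forall X, iso (tensor X unit_obj) X;
  assoc : forall X Y Z, iso (tensor X (tensor Y Z)) (tensor (tensor X Y) Z);
  lunit_nat : forall X Y (f : mor X Y),
    f ∘ iso_hom (lunit X) = iso_hom (lunit Y) ∘ bmor tensor (idm unit_obj) f;
  runit_nat : forall X Y (f : mor X Y),
    f ∘ iso_hom (runit X) = iso_hom (runit Y) ∘ bmor tensor f (idm unit_obj);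
  assoc_nat : forall X X' Y Y' Z Z'
    (f : mor X X') (g : mor Y Y') (h : mor Z Z'),
    bmor tensor (bmor tensor f g) h ∘ iso_hom (assoc X Y Z) =
    iso_hom (assoc X' Y' Z') ∘ bmor tensor f (bmor tensor g h);
  tensor_triangle : forall X Y,
    bmor tensor (iso_hom (runit X)) (idm Y) ∘ iso_hom (assoc X unit_obj Y) =
    bmor tensor (idm X) (iso_hom (lunit Y));
  tensor_pentagon : forall W X Y Z,
    iso_hom (assoc (tensor W X) Y Z) ∘ iso_hom (assoc W X (tensor Y Z)) =
    bmor tensor (iso_hom (assoc W X Y)) (idm Z)
      ∘ iso_hom (assoc W (tensor X Y) Z)
      ∘ bmor tensor (idm W) (iso_hom (assoc X Y Z))
}.

Arguments tensor {F m}.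
Arguments unit_obj {F m}.
Arguments lunit {F m} X.
Arguments runit {F m} X.
Arguments assoc {F m} X Y Z.

Notation "X ⊗ Y" := (bobj tensor X Y)
  (at level 39, left associativity) : cat_scope.
Notation "f ⊗₁ g" := (bmor tensor f g)
  (at level 39, left associativity) : cat_scope.
Notation "𝟙" := unit_obj : cat_scope.

(* Hom-sets are F-vector spaces, as Hom_M(- ⊗ M, M) takes values in vector
   spaces; the action is an arbitrary bifunctor, not assumed bilinear, and the
   underlying category is not assumed abelian. *)
Record module_category (F : fieldType) (C : multitensor_category F) :=
ModuleCategory {
  md_cat :> linear_category F;
  act : bifunctor C md_cat md_cat;
  act_lunit : forall M, iso (act 𝟙 M) M;
  act_assoc : forall (X Y : C) M,
    iso (act X (act Y M)) (act (X ⊗ Y) M);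
  act_lunit_nat : forall M N (f : mor M N),
    f ∘ iso_hom (act_lunit M) = iso_hom (act_lunit N) ∘ bmor act (idm 𝟙) f;
  act_assoc_nat : forall (X X' Y Y' : C) M M'
    (f : mor X X') (g : mor Y Y') (h : mor M M'),
    bmor act (f ⊗₁ g) h ∘ iso_hom (act_assoc X Y M) =
    iso_hom (act_assoc X' Y' M') ∘ bmor act f (bmor act g h);
  act_triangle : forall (X : C) M,
    bmor act (iso_hom (runit X)) (idm M) ∘ iso_hom (act_assoc X 𝟙 M) =
    bmor act (idm X) (iso_hom (act_lunit M));
  act_pentagon : forall (X Y Z : C) M,
    iso_hom (act_assoc (X ⊗ Y) Z M) ∘ iso_hom (act_assoc X Y (act Z M)) =
    bmor act (iso_hom (assoc X Y Z)) (idm M)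
      ∘ iso_hom (act_assoc X (Y ⊗ Z) M)
      ∘ bmor act (idm X) (iso_hom (act_assoc Y Z M))
}.

Arguments act {F C m}.
Arguments act_lunit {F C m} M.
Arguments act_assoc {F C m} X Y M.

Notation "X ▷ M" := (bobj act X M)
  (at level 39, left associativity) : cat_scope.
Notation "f ▷₁ g" := (bmor act f g)
  (at level 39, left associativity) : cat_scope.


Record presheaf (F : fieldType) (C : linear_category F) := Presheaf {
  pobj :> C -> lmodType F;
  pmap : forall X Y, mor X Y -> pobj Y -> pobj X;
  pmap_linear : forall X Y (f : mor X Y), linear (pmap f);
  pmap_id : forall X (a : pobj X), pmap (idm X) a = a;
  pmap_comp : forall X Y Z (g : mor Y Z) (f : mor X Y) (a : pobj Z),
    pmap (g ∘ f) a = pmap f (pmap g a)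
}.

Record nat_iso (F : fieldType) (C : linear_category F) (P Q : presheaf C) :=
NatIso {
  nt_fun :> forall X, P X -> Q X;
  nt_inv : forall X, Q X -> P X;
  nt_linear : forall X, linear (@nt_fun X);
  nt_funK : forall X, cancel (@nt_fun X) (@nt_inv X);
  nt_invK : forall X, cancel (@nt_inv X) (@nt_fun X);
  nt_natural : forall X Y (f : mor X Y) (a : P Y),
    nt_fun (pmap f a) = pmap f (nt_fun a)
}.

Arguments nt_fun {F C P Q} n X _.
Arguments nt_inv {F C P Q} n X _.

Definition yoneda (F : fieldType) (C : linear_category F) (A : C) :
  presheaf C.
Proof.
apply: (@Presheaf F C (fun X => mor X A) (fun X Y f g => g ∘ f)).
- by move=> X Y f; apply: compm_linear_l.
- by move=> X g; apply: compm_idr.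
- by move=> X Y Z g f a; apply: compmA.
Defined.

(* [hom_presheaf M N] is G_{M,N} : X |-> Hom(X ⊗ M, N). *)
Definition hom_presheaf (F : fieldType) (C : multitensor_category F)
  (D : module_category C) (M N : D) : presheaf C.
Proof.
apply: (@Presheaf F C (fun X => mor (X ▷ M) N)
          (fun X Y f g => g ∘ (f ▷₁ idm M))).
- by move=> X Y f; apply: compm_linear_l.
- by move=> X g; rewrite bmor_id compm_idr.
- by move=> X Y Z g f a; rewrite -compmA -bmor_comp compm_idl.
Defined.

Definition representation (F : fieldType) (C : linear_category F)
  (P : presheaf C) (A : C) := nat_iso P (yoneda A).

Record left_unital_algebra (F : fieldType) (C : multitensor_category F)
    (A : C) (iota : mor 𝟙 A) (m : mor (A ⊗ A) A) : Prop :=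
LeftUnitalAlgebra {
  alg_assoc : m ∘ (idm A ⊗₁ m) = m ∘ (m ⊗₁ idm A) ∘ iso_hom (assoc A A A);
  alg_lunit : m ∘ (iota ⊗₁ idm A) = iso_hom (lunit A)
}.

(* Main.v *)
Require Import Defs.
From mathcomp Require Import all_boot all_algebra.

Local Open Scope cat_scope.

(** A morphism f : X -> A is determined by ev ∘ (f ▷ id), since this is the
    inverse of λ_X; under this correspondence m and ι become "evaluate twice"
    and the unit isomorphism of M. Associativity then follows from the pentagon
    and the interchange law, and the left unit law from the compatibility of
    the associator with left units, which is derived by Kelly's argument. *)

Lemma iso_hom_epi {F : fieldType} {C : linear_category F} {X Y Z : C}
    (i : iso X Y) (f g : mor Y Z) :
  f ∘ iso_hom i = g ∘ iso_hom i -> f = g.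
Proof.
move=> fg.
by rewrite -(compm_idr f) -(compm_idr g) -(iso_invK i) !compmA fg.
Qed.

Lemma iso_hom_mono {F : fieldType} {C : linear_category F} {X Y Z : C}
    (i : iso Y Z) (f g : mor X Y) :
  iso_hom i ∘ f = iso_hom i ∘ g -> f = g.
Proof.
move=> fg.
by rewrite -(compm_idl f) -(compm_idl g) -(iso_homK i) -!compmA fg.
Qed.

Section ModuleCategory.
Context {F : fieldType} {C : multitensor_category F} {D : module_category C}.

Lemma act_comp_l {X Y Z : C} (M : D) (g : mor Y Z) (f : mor X Y) :
  (g ∘ f) ▷₁ idm M = (g ▷₁ idm M) ∘ (f ▷₁ idm M).
Proof. by rewrite -bmor_comp compm_idl. Qed.

Lemma act_comp_r (X : C) {M N P : D} (g : mor N P) (f : mor M N) :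
  idm X ▷₁ (g ∘ f) = (idm X ▷₁ g) ∘ (idm X ▷₁ f).
Proof. by rewrite -bmor_comp compm_idl. Qed.

Lemma act_interchange {X Y : C} {M N : D} (f : mor X Y) (g : mor M N) :
  (idm Y ▷₁ g) ∘ (f ▷₁ idm M) = (f ▷₁ idm N) ∘ (idm X ▷₁ g).
Proof. by rewrite -!bmor_comp !compm_idl !compm_idr. Qed.

(** Naturality of [act_lunit] conjugates [idm 𝟙 ▷₁ f] into [f]. *)
Lemma act_unit_faithful {M N : D} (f g : mor M N) :
  idm 𝟙 ▷₁ f = idm 𝟙 ▷₁ g -> f = g.
Proof.
by move=> fg; apply: (iso_hom_epi (act_lunit M)); rewrite !act_lunit_nat fg.
Qed.

(* After tensoring with 𝟙, this follows from the pentagon for 𝟙, 𝟙, X, M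
   and the two triangle axioms. *)
Lemma act_lunit_assoc (X : C) (M : D) :
  (iso_hom (lunit X) ▷₁ idm M) ∘ iso_hom (act_assoc 𝟙 X M)
  = iso_hom (act_lunit (X ▷ M)).
Proof.
apply: act_unit_faithful; apply: (iso_hom_mono (act_assoc 𝟙 X M)).
rewrite act_comp_r compmA -act_assoc_nat -tensor_triangle act_comp_l.
rewrite -act_triangle compmA -(bmor_id act) -act_assoc_nat.
by rewrite -[RHS]compmA act_pentagon !compmA.
Qed.

End ModuleCategory.

Section InternalEnd.
Context {F : fieldType} {C : multitensor_category F} {D : module_category C}.
Context {M : D} {A : C} (lam : representation (hom_presheaf M M) A).

Let ev : mor (A ▷ M) M := nt_inv lam A (idm A).
Let m : mor (A ⊗ A) A :=
  nt_fun lam (A ⊗ A) (ev ∘ (idm A ▷₁ ev) ∘ iso_inv (act_assoc A A M)).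

(** The Yoneda argument: naturality of [lam] along [f], applied to [ev], whose image is [idm A]. *)
Lemma lam_ev {X : C} (f : mor X A) : nt_fun lam X (ev ∘ (f ▷₁ idm M)) = f.
Proof.
rewrite [LHS](nt_natural lam f ev) /= /ev.
have -> : nt_fun lam A (nt_inv lam A (idm A)) = idm A by exact: nt_invK.
exact: compm_idl.
Qed.

Lemma ev_lam {X : C} (g : mor (X ▷ M) M) :
  ev ∘ (nt_fun lam X g ▷₁ idm M) = g.
Proof.
exact: (can_inj (@nt_funK _ _ _ _ lam X)) (lam_ev (nt_fun lam X g)).
Qed.

Lemma ev_inj {X : C} (f g : mor X A) :
  ev ∘ (f ▷₁ idm M) = ev ∘ (g ▷₁ idm M) -> f = g.
Proof. by move=> fg; rewrite -(lam_ev f) fg lam_ev. Qed.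

(** Both algebra laws use [m] only through this equation. *)
Lemma ev_mul :
  ev ∘ (m ▷₁ idm M) ∘ iso_hom (act_assoc A A M) = ev ∘ (idm A ▷₁ ev).
Proof. by rewrite ev_lam -compmA iso_homK compm_idr. Qed.

Lemma internal_end_lunit :
  m ∘ (nt_fun lam 𝟙 (iso_hom (act_lunit M)) ⊗₁ idm A) = iso_hom (lunit A).
Proof.
apply: ev_inj; apply: (iso_hom_epi (act_assoc 𝟙 A M)).
(* Both sides reduce to [iso_hom (act_lunit M) ∘ (idm 𝟙 ▷₁ ev)]. *)
rewrite -[RHS]compmA act_lunit_assoc act_lunit_nat.
rewrite act_comp_l -!compmA act_assoc_nat bmor_id !compmA ev_mul.
by rewrite -compmA act_interchange compmA ev_lam.
Qed.

Lemma internal_end_assoc :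
  m ∘ (idm A ⊗₁ m) = m ∘ (m ⊗₁ idm A) ∘ iso_hom (assoc A A A).
Proof.
apply: ev_inj; apply: (iso_hom_epi (act_assoc A (A ⊗ A) M)).
(* Inserting this identity moves the comparison to [A ▷ (A ▷ (A ▷ M))], where the pentagon
   starts. *)
have assocK : (idm A ▷₁ iso_hom (act_assoc A A M))
    ∘ (idm A ▷₁ iso_inv (act_assoc A A M)) = idm _.
  by rewrite -act_comp_r iso_invK bmor_id.
rewrite -[LHS]compm_idr -[RHS]compm_idr -assocK !compmA; congr (_ ∘ _).
(* The common value is threefold evaluation; the left side reaches it by [ev_mul], first for the
   outer [m], then for the inner one. *)
transitivity (ev ∘ (idm A ▷₁ ev) ∘ (idm A ▷₁ (idm A ▷₁ ev))).
  rewrite act_comp_l -!compmA [_ ∘ (_ ∘ (idm A ▷₁ _))]compmA act_assoc_nat.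
  rewrite !compmA ev_mul -!compmA -!act_comp_r.
  by rewrite compmA ev_mul.
rewrite !act_comp_l !compmA.
(* The two outer evaluations fold back into [m], giving a form that the other side reaches too. *)
rewrite -ev_mul -[LHS]compmA -act_assoc_nat bmor_id.
symmetry; rewrite -!compmA (compmA (_ ▷₁ _) (iso_hom _) (_ ▷₁ _)).
(* The pentagon absorbs [assoc A A A]; then [m ⊗₁ idm A] slides past the remaining associator and
   [ev_mul] applies. *)
rewrite -act_pentagon !compmA -(compmA _ _ (iso_hom (act_assoc (A ⊗ A) A M))).
rewrite act_assoc_nat bmor_id !compmA ev_mul -(compmA ev) act_interchange.
by rewrite !compmA.
Qed.

End InternalEnd.

Theorem theorem3p2 (F : fieldType) (C : multitensor_category F)
    (D : module_category C) (M : D) (A : C)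
    (lam : representation (hom_presheaf M M) A) :
  let iota : mor 𝟙 A := nt_fun lam 𝟙 (iso_hom (act_lunit M)) in
  let ev : mor (A ▷ M) M := nt_inv lam A (idm A) in
  let m : mor (A ⊗ A) A :=
    nt_fun lam (A ⊗ A) (ev ∘ (idm A ▷₁ ev) ∘ iso_inv (act_assoc A A M)) in
  left_unital_algebra iota m.
Proof.
by split; [exact: internal_end_assoc | exact: internal_end_lunit].
Qed.
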